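(* Let $M\in\mathbb{C}[x_0,x_1]$ be a binary monomial of degree $3d$. Then: (1) $\#_3(M)=1$ if $M$ is a pure cube; (2) $\#_3(M)=3$ otherwise.
   Context: A binary monomial is $x_0^{a_0}x_1^{a_1}$ with non-negative integer exponents; it is a pure cube if it is the cube of a monomial. A form of degree $d$ is a homogeneous polynomial of degree $d$ with complex coefficients (forms of degree $0$ are constants). For a form $F\in\mathbb{C}[x_0,x_1]$ of degree $3d$, the $3^{rd}$-Waring rank of $F$ is $\#_3(F):=\min\{s \mid F=g_1^3+\cdots+g_s^3 \text{ for some forms } g_1,\ldots,g_s\in\mathbb{C}[x_0,x_1] \text{ of degree } d\}$. *)

(* Defs.v *)
From HB Require Import structures.
From mathcomp Require Import all_boot all_order all_algebra.
From mathcomp Require Import reals.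
From mathcomp Require Import complex mpoly.

Set Implicit Arguments.
Unset Strict Implicit.
Unset Printing Implicit Defensive.

Import GRing.Theory.
Local Open Scope ring_scope.

(* R is the field of real numbers (any realType), so that R[i] is C and
   {mpoly R[i][2]} is C[x_0, x_1]. *)

Definition binary_monomial (R : realType) (M : {mpoly R[i][2]}) : Prop :=
  exists a0 a1 : nat, M = 'X_(0 : 'I_2) ^+ a0 * 'X_(1 : 'I_2) ^+ a1.

Definition pure_cube (R : realType) (M : {mpoly R[i][2]}) : Prop :=
  exists2 N : {mpoly R[i][2]}, binary_monomial N & M = N ^+ 3.

(* The zero polynomial is d.-homog for every d; allowing it among the g i does
   not affect the minimal number of summands. *)
Definition sum_of_cubes (R : realType) (d : nat) (F : {mpoly R[i][2]})
    (s : nat) : Prop :=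
  exists g : 'I_s -> {mpoly R[i][2]},
    (forall i, g i \is d.-homog) /\ F = \sum_(i < s) g i ^+ 3.

(* #_3(F) = s, for F a form of degree 3d: the set of which #_3(F) is the
   minimum has s as its least element. *)
Definition waring_rank3_is (R : realType) (d : nat) (F : {mpoly R[i][2]})
    (s : nat) : Prop :=
  sum_of_cubes d F s /\ forall t : nat, sum_of_cubes d F t -> (s <= t)%N.

(* Main.v *)
Require Import Defs.
From HB Require Import structures.
From mathcomp Require Import all_boot all_order all_algebra.
From mathcomp Require Import reals.
From mathcomp Require Import complex mpoly.
From mathcomp Require Import ring zify.

(** A pure cube is by definition one cube of a form, and no nonzero polynomial
    is an empty sum. A monomial of degree 3d that is not a pure cube has its
    exponents congruent to 1 and 2 modulo 3, so it is N^3 x y^2 with N a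
    monomial of degree d - 1 and {x, y} the two variables; a classical identity
    writes x y^2 as three cubes of linear forms ([mul_sqr_three_cubes]), hence
    three cubes suffice.

    Two cubes do not suffice. With w a primitive cube root of unity,
    P^3 + Q^3 = (P + Q)(P + wQ)(P + w^2 Q), and the three factors u, v, t
    satisfy the linear relation u + w v + w^2 t = 0. If their product is a
    monomial, each of them is a scalar multiple of a monomial, and a relation
    with nonzero coefficients among three monomials forces them to be equal:
    the product is then, up to a scalar, the cube of a monomial. Setting all
    variables but one equal to 1 maps monomials to powers of that variable and
    sums of cubes to sums of cubes, so it is enough to run this argument in one
    variable, where the divisors of 'X^n are known ([Xn_sum_two_cubes]); the
    conclusion is that every exponent is a multiple of 3
    ([mpolyX_sum_two_cubes]). Since P or Q may be zero, this covers sums of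
    fewer cubes too. *)

Set Implicit Arguments.
Unset Strict Implicit.
Unset Printing Implicit Defensive.

Import GRing.Theory Num.Theory.

Local Open Scope ring_scope.

Lemma dvdp_Xn_scale (F : fieldType) (q : {poly F}) n :
  q %| 'X^n -> exists c k, c != 0 /\ q = c *: 'X^k.
Proof.
rewrite -['X]subr0 -polyC0 => /dvdp_exp_XsubCP [k _ /eqpf_eq [c c0 ->]].
by exists c, k; rewrite subr0.
Qed.

(** Each of the three monomials must be cancelled by another one, which leaves
    no room for two different exponents. *)
Lemma lin_rel_Xn_eq (F : fieldType) (a b c : F) i j k :
  a != 0 -> b != 0 -> c != 0 -> a *: 'X^i + b *: 'X^j + c *: 'X^k = 0 ->
  i = j /\ j = k.
Proof.
move=> a0 b0 c0 rel.
have coef n : a * (n == i)%:R + b * (n == j)%:R + c * (n == k)%:R = 0.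
  by have := congr1 (fun p : {poly F} => p`_n) rel; rewrite !coefE.
have ci : (i == j) || (i == k).
  apply: contraT; rewrite negb_or => /andP[/negPf ij /negPf ik].
  by have /eqP := coef i; rewrite eqxx ij ik mulr1 !mulr0 !addr0 (negPf a0).
have cj : (j == i) || (j == k).
  apply: contraT; rewrite negb_or => /andP[/negPf ji /negPf jk].
  by have /eqP := coef j; rewrite eqxx ji jk mulr1 !mulr0 addr0 add0r (negPf b0).
have ck : (k == i) || (k == j).
  apply: contraT; rewrite negb_or => /andP[/negPf ki /negPf kj].
  by have /eqP := coef k; rewrite eqxx ki kj mulr1 !mulr0 !add0r (negPf c0).
by lia.
Qed.

Lemma cube_root1 (C : numClosedFieldType) : exists w : C, w ^+ 2 + w + 1 = 0.
Proof.
exists ((sqrtC (- 3) - 1) / 2).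
transitivity ((sqrtC (- 3 : C) ^+ 2 + 3) / 4); first by field.
by rewrite sqrtCK addNr mul0r.
Qed.

Lemma Xn_sum_two_cubes (C : numClosedFieldType) (p q : {poly C}) n :
  'X^n = p ^+ 3 + q ^+ 3 -> (3 %| n)%N.
Proof.
have [w hw] := cube_root1 C => Xn.
have w0 : w != 0.
  by apply/eqP => w0; move/eqP: hw; rewrite w0 expr0n !add0r oner_eq0.
pose W : {poly C} := w%:P.
have hW : W ^+ 2 + W + 1 = 0 by rewrite -polyC_exp -!polyCD hw polyC0.
(* The two cofactors of W^2 + W + 1 below are quotients by polynomial division
   in W. *)
pose u := p + q; pose v := p + W * q; pose t := p + W ^+ 2 * q.
have fact : 'X^n = u * v * t.
  rewrite Xn /u /v /t; apply/eqP; rewrite -subr_eq0; apply/eqP.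
  transitivity (- (W ^+ 2 + W + 1) * (p ^+ 2 * q + W * p * q ^+ 2
                                      + (W - 1) * q ^+ 3)); first by ring.
  by rewrite hW oppr0 mul0r.
have rel : u + W * v + W ^+ 2 * t = 0.
  transitivity ((W ^+ 2 + W + 1) * (p + (W ^+ 2 - W + 1) * q)).
    by rewrite /u /v /t; ring.
  by rewrite hW mul0r.
have [a [i [a0 eu]]] : exists c k, c != 0 /\ u = c *: 'X^k.
  by apply: (@dvdp_Xn_scale _ _ n); rewrite fact -mulrA dvdp_mulr.
have [b [j [b0 ev]]] : exists c k, c != 0 /\ v = c *: 'X^k.
  by apply: (@dvdp_Xn_scale _ _ n); rewrite fact dvdp_mulr ?dvdp_mull.
have [c [k [c0 et]]] : exists c k, c != 0 /\ t = c *: 'X^k.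
  by apply: (@dvdp_Xn_scale _ _ n); rewrite fact dvdp_mull.
have [ij jk] : i = j /\ j = k.
  apply: (@lin_rel_Xn_eq _ a (w * b) (w ^+ 2 * c)).
  - by [].
  - by rewrite mulf_neq0.
  - by rewrite mulf_neq0 ?expf_neq0.
  - by rewrite -[(w * b) *: _]scalerA -[(_ * c) *: _]scalerA -eu -ev -et
       -!mul_polyC polyC_exp.
move/(congr1 (size \o polyseq)): fact.
rewrite /= eu ev et ij jk -!scalerAl -!scalerAr -!scalerAl -!exprD.
rewrite !size_scale // !size_polyXn => -[->].
by apply/dvdnP; exists k; lia.
Qed.

(** Setting every variable except the j-th one to 1 reduces this to one
    variable. *)
Lemma mpolyX_sum_two_cubes (C : numClosedFieldType) n (m : 'X_{1..n})
    (p q : {mpoly C[n]}) (j : 'I_n) :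
  'X_[m] = p ^+ 3 + q ^+ 3 -> (3 %| m j)%N.
Proof.
pose h (i : 'I_n) : {poly C} := if i == j then 'X else 1.
move/(congr1 (mmap (@polyC C) h)).
rewrite mmapX rmorphD !rmorphXn /= /mmap1 (bigD1 j) //= big1; last first.
  by move=> i /negPf ij; rewrite /h ij expr1n.
by rewrite /h eqxx mulr1 => /Xn_sum_two_cubes.
Qed.

(** From (z + y)^3 + (z - y)^3 - 2 z^3 = 6 z y^2 with z = x / 6; the last term
    becomes a cube by means of a cube root of -2. *)
Lemma mul_sqr_three_cubes (C : numClosedFieldType) n (x y : {mpoly C[n]}) :
  exists c e : C,
    x * y ^+ 2 = (c *: x + y) ^+ 3 + (c *: x - y) ^+ 3 + (e *: x) ^+ 3.
Proof.
pose r : C := 3.-root (- 2); have hr : r ^+ 3 = - 2 by rewrite rootCK.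
exists 6^-1, (r / 6); rewrite -!mul_mpolyC mpolyCM.
have h6 : 6 * (6^-1 : C)%:MP_[n] = 1.
  by rewrite -(@mpolyC_nat n C 6) -mpolyCM mulfV ?mpolyC1 // pnatr_eq0.
have hR : r%:MP_[n] ^+ 3 = - 2 by rewrite -rmorphXn /= hr mpolyCN mpolyC_nat.
set s := (6^-1)%:MP_[n] in h6 *.
transitivity ((6 * s) * (x * y ^+ 2) + (r%:MP_[n] ^+ 3 + 2) * (s * x) ^+ 3).
  by rewrite h6 hR addNr mul0r mul1r addr0.
by ring.
Qed.

Section Binary.

Variable R : realType.

Let x0 : {mpoly R[i][2]} := 'X_(0 : 'I_2).
Let x1 : {mpoly R[i][2]} := 'X_(1 : 'I_2).

Lemma binary_monomialE a b :
  x0 ^+ a * x1 ^+ b = 'X_[U_(0 : 'I_2) *+ a + U_(1 : 'I_2) *+ b].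
Proof. by rewrite mpolyXD !mpolyXn. Qed.

Lemma dhomog_binary_monomial a b d :
  (x0 ^+ a * x1 ^+ b \is d.-homog) = (a + b == d)%N.
Proof. by rewrite binary_monomialE dhomogX /= mdegD !mdegMn !mdeg1 !mul1n. Qed.

Lemma binary_monomial_sum_cubes_lt3 d a b t :
  (t < 3)%N -> sum_of_cubes d (x0 ^+ a * x1 ^+ b) t -> (3 %| a)%N && (3 %| b)%N.
Proof.
move=> t3 [g [_]]; rewrite binary_monomialE; set m := (_ + _)%MM => hg.
(* Shorter sums are padded with zero cubes. *)
have [p [q hpq]] : exists p q : {mpoly R[i][2]}, 'X_[m] = p ^+ 3 + q ^+ 3.
  case: t t3 g hg => [|[|[|//]]] _ g ->.
  - by exists 0, 0; rewrite big_ord0 expr0n addr0.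
  - by exists (g ord0), 0; rewrite big_ord1 expr0n addr0.
  - by exists (g ord0), (g ord_max); rewrite big_ord_recl big_ord1;
      congr (_ + g _ ^+ 3); apply: val_inj.
have := mpolyX_sum_two_cubes 0 hpq; have := mpolyX_sum_two_cubes 1 hpq.
by rewrite !mnmDE !mulmnE !mnm1E /= !mul0n !mul1n addn0 => -> ->.
Qed.

Lemma pure_cube_binary_monomial a b :
  (3 %| a)%N -> (3 %| b)%N -> pure_cube (x0 ^+ a * x1 ^+ b).
Proof.
move=> /dvdnP[k ->] /dvdnP[l ->]; exists (x0 ^+ k * x1 ^+ l).
  by exists k, l.
by rewrite exprMn -!exprM.
Qed.

Lemma sum_of_three_cubes_mul_sqr d (n x y : {mpoly R[i][2]}) :
  n \is d.-homog -> x \is 1.-homog -> y \is 1.-homog ->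
  sum_of_cubes d.+1 (n ^+ 3 * (x * y ^+ 2)) 3.
Proof.
move=> hn hx hy; have [c [e xyy]] := mul_sqr_three_cubes x y.
pose g := tnth [tuple n * (c *: x + y); n * (c *: x - y); n * (e *: x)].
exists g; split=> [i|]; last first.
  by rewrite xyy !mulrDr -!exprMn !big_ord_recl big_ord0 addr0 addrA.
have hz c' : c' *: x \is 1.-homog by rewrite dhomogZ.
rewrite -[d.+1]addn1; have : g i \in
    [:: n * (c *: x + y); n * (c *: x - y); n * (e *: x)].
  exact: mem_tnth.
by rewrite !inE => /or3P[] /eqP ->; apply: dhomogM => //;
  rewrite ?rpredB ?rpredD.
Qed.

End Binary.

Theorem corollary3p6 (R : realType) (d : nat) (M : {mpoly R[i][2]})
    (hM : binary_monomial M) (hdeg : M \is (3 * d)%N.-homog) :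
  (pure_cube M -> waring_rank3_is d M 1%N) /\
  (~ pure_cube M -> waring_rank3_is d M 3%N).
Proof.
case: hM hdeg => a [b ->]; rewrite dhomog_binary_monomial => /eqP abd.
split=> [[_ [k [l ->]] hN]|hN].
  split=> [|[|//] [g [_ ]]].
    exists (fun=> 'X_0 ^+ k * 'X_1 ^+ l); rewrite big_ord1; split=> // _.
    have : ('X_0 ^+ a * 'X_1 ^+ b : {mpoly R[i][2]}) \is (3 * d)%N.-homog.
      by rewrite dhomog_binary_monomial abd.
    rewrite hN exprMn -!exprM !dhomog_binary_monomial; lia.
  rewrite big_ord0 binary_monomialE => /(congr1 (@msupp _ _)).
  by rewrite msuppX msupp0.
split=> [|t]; last first.
  case: ltnP => // t3 /(binary_monomial_sum_cubes_lt3 t3) /andP[a3 b3].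
  by case: hN; apply: pure_cube_binary_monomial.
have nab : ~~ ((3 %| a)%N && (3 %| b)%N).
  by apply/andP => -[a3 b3]; apply: hN; apply: pure_cube_binary_monomial.
have hX (i : 'I_2) : ('X_i : {mpoly R[i][2]}) \is 1.-homog.
  by rewrite dhomogX /= mdeg1.
have hN3 k l (x y : {mpoly R[i][2]}) : x \is 1.-homog -> y \is 1.-homog ->
    d = (k + l).+1 ->
    sum_of_cubes d (('X_0 ^+ k * 'X_1 ^+ l) ^+ 3 * (x * y ^+ 2)) 3.
  move=> hx hy ->; apply: sum_of_three_cubes_mul_sqr => //.
  by rewrite dhomog_binary_monomial.
(* Modulo 3 the exponents add up to 0 and are not both 0. *)
have [[ma mb]|[ma mb]] : (a %% 3 = 1 /\ b %% 3 = 2 \/ a %% 3 = 2 /\ b %% 3 = 1)%N.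
  by lia.
- have -> : 'X_0 ^+ a * 'X_1 ^+ b = ('X_0 ^+ (a %/ 3)%N * 'X_1 ^+ (b %/ 3)%N) ^+ 3
      * ('X_0 * 'X_1 ^+ 2) :> {mpoly R[i][2]}.
    rewrite {1}(divn_eq a 3) {1}(divn_eq b 3) ma mb !exprD !exprM; ring.
  by apply: hN3 => //; lia.
- have -> : 'X_0 ^+ a * 'X_1 ^+ b = ('X_0 ^+ (a %/ 3)%N * 'X_1 ^+ (b %/ 3)%N) ^+ 3
      * ('X_1 * 'X_0 ^+ 2) :> {mpoly R[i][2]}.
    rewrite {1}(divn_eq a 3) {1}(divn_eq b 3) ma mb !exprD !exprM; ring.
  by apply: hN3 => //; lia.
Qed.
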